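(* Let $T$ be a tree of type $cH$ with parameters $(s,t;a)$. Then $T$ is a path-like tree if and only if one of the following holds: (i) there exist a divisor $\alpha$ of $s$ and a divisor $\beta$ of $t$ such that $\alpha-\beta=a-1$, where $s-a\ge a-1$; (ii) either $s-a+1=t$ or $a=t$; (iii) either $a$ or $s-a+1$ is a divisor of $t$.
   Context: A tree of type $cH$ with parameters $(s,t;a)$, where $1<a<s$ and $t\ge1$, is the tree with vertex set $\{u_1,\ldots,u_s,v_1,\ldots,v_t\}$ and edge set $\{u_av_1\}\cup\{u_1u_2,\ldots,u_{s-1}u_s\}\cup\{v_1v_2,\ldots,v_{t-1}v_t\}$. Path-like trees. Embed the path $P_n$ as a subgraph of a $2$-dimensional grid $P_k\times P_l$. For such an embedding consider the ordered sequence of subpaths $L_1,\ldots,L_m$ which are maximal straight segments of the embedding, the end of $L_i$ being the beginning of $L_{i+1}$. Suppose $L_i\cong P_2$ for some $i$ and some vertex $u$ of $L_{i-1}$ is at distance $1$ in the grid from a vertex $v$ of $L_{i+1}$. An elementary transformation replaces the edge of $L_i$ by the new edge $uv$. A tree $T$ of order $n$ is a path-like tree if it can be obtained from some embedding of $P_n$ in the $2$-dimensional grid by a sequence of elementary transformations.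
   Formalization: The parameters (s,t;a) are not determined by T, and for fixed parameters ''only if'' fails: (5,1;3) is path-like but meets none of (i)-(iii), though the same tree has parameters (4,2;2). Proved instead: T is path-like iff some choice of its parameters satisfies (i), (ii) or (iii). *)

(* Defs.v *)
From mathcomp Require Import all_boot.

Set Implicit Arguments.
Unset Strict Implicit.
Unset Printing Implicit Defensive.

(* A simple graph is given by its adjacency relation on a finite vertex type. *)

Definition graph_iso (V W : finType) (e : rel V) (e' : rel W) : Prop :=
  exists2 f : V -> W, bijective f & forall x y, e x y = e' (f x) (f y).

Definition path_adj n : rel 'I_n :=
  fun i j => (i.+1 == j :> nat) || (j.+1 == i :> nat).

(* The Cartesian product of the paths P_k and P_l. *)
Definition grid_adj k l : rel ('I_k * 'I_l) :=
  fun x y => ((x.1 == y.1) && path_adj x.2 y.2)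
          || ((x.2 == y.2) && path_adj x.1 y.1).

(* u_i is inl (i - 1) and v_j is inr (j - 1): ordinals start at 0. *)
Definition cH_adj (s t a : nat) : rel ('I_s + 'I_t) :=
  fun x y => match x, y with
  | inl i, inl j => path_adj i j
  | inr i, inr j => path_adj i j
  | inl i, inr j => (i.+1 == a) && (j == 0 :> nat)
  | inr j, inl i => (i.+1 == a) && (j == 0 :> nat)
  end.

(* The parameters of a tree of type cH are not determined by the tree, since
   any two of its three legs may be taken as the two ends of u_1 ... u_s:
   for instance (4,2;2), (4,2;3) and (5,1;3) are parameters of the same tree.
   An arithmetic condition on (s,t;a) thus becomes a property of the tree only
   as a condition on some choice of its parameters; a = t, say, holds for the
   first of these triples and not for the last. *)
Definition cH_parameters (V : finType) (T : rel V) (s t a : nat) : Prop :=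
  [/\ 1 < a < s, 1 <= t & graph_iso T (@cH_adj s t a)].

Definition type_cH (V : finType) (T : rel V) : Prop :=
  exists s t a, cH_parameters T s t a.

Section Embedding.
Variables (n k l : nat) (p : 'I_n -> 'I_k * 'I_l).

Definition embedding : Prop :=
  injective p /\ (forall i j, path_adj i j -> grid_adj (p i) (p j)).

Definition straight (b e : 'I_n) : Prop :=
  (forall i : 'I_n, b <= i <= e -> (p i).1 = (p b).1) \/
  (forall i : 'I_n, b <= i <= e -> (p i).2 = (p b).2).

(* The subpath on the vertices b, ..., e is one of the segments L_i. *)
Definition segment (b e : 'I_n) : Prop :=
  [/\ b < e, straight b e &
      forall b' e' : 'I_n, b' <= b -> e <= e' -> straight b' e' ->
        b' = b /\ e' = e].

Definition path_edges : {set {set 'I_n}} :=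
  [set [set ij.1; ij.2] | ij : 'I_n * 'I_n & path_adj ij.1 ij.2].

(* E and E' are the edge sets before and after the transformation. The segments
   are those of the embedded path throughout: L_(i-1) runs from b0 to b1, L_i
   is the single edge b1 b2, and L_(i+1) runs from b2 to b3. *)
Definition elementary_transformation (E E' : {set {set 'I_n}}) : Prop :=
  exists b0 b1 b2 b3 u v : 'I_n,
    [/\ [/\ segment b0 b1, segment b1 b2 & segment b2 b3],
        b2 = b1.+1 :> nat /\ [set b1; b2] \in E,
        b0 <= u <= b1 /\ b2 <= v <= b3,
        grid_adj (p u) (p v) &
        E' = [set u; v] |: (E :\ [set b1; b2])].

Inductive obtainable : {set {set 'I_n}} -> Prop :=
| obtainable_path : obtainable path_edges
| obtainable_step E E' :
    obtainable E -> elementary_transformation E E' -> obtainable E'.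

End Embedding.

Definition path_like (V : finType) (T : rel V) : Prop :=
  exists k l (p : 'I_#|V| -> 'I_k * 'I_l) (E : {set {set 'I_#|V|}}),
    [/\ embedding p, obtainable p E &
        graph_iso T (fun i j => [set i; j] \in E)].

(* Main.v *)
(** Throughout an obtainable edge set the path edge between positions [g - 1]
    and [g] is either untouched or replaced by an edge that is symmetric about
    it, so the tree is described by a radius function [J]: crease [g] carries
    the edge joining [g - J g] and [g + J g - 1], and [J g = 1] means that it is
    untouched.  The embeddings impose only that the reach of a crease with
    [J g > 1] stops at the neighbouring such creases and at the ends of the
    path ([folding]); conversely every such [J] is realised by a boustrophedon
    embedding.

    A fold edge that ends in the interior of a straight row creates a vertex of
    degree at least 3, and these are the only such vertices.  A tree of type cH
    has one, of degree 3, so exactly one end of one fold edge is interior.  All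
    other folds then join rows of equal width: up to reversal there are [m] rows
    of width [x] followed by [k] rows of width [y > x].  This tree has parameters
    [(k * y, m * x; y - x + 1)], which is condition (i) with [alpha = y] and
    [beta = x] when [k >= 2], and condition (iii) when [k = 1]. *)

Require Import Defs.
From mathcomp Require Import all_boot zify.

(** * Folded paths and vertices of degree 3 *)

(** The ends [g - J g] and [g + J g - 1] of the edge at crease [g] add up to [2 * g - 1], so they
    determine [g]. Additive equations avoid truncated subtraction. *)
Definition fold_adj (J : nat -> nat) (u v : nat) : bool :=
  let g := (u + v).+1./2 in
  ((u + J g == g) && (v.+1 == g + J g)) || ((v + J g == g) && (u.+1 == g + J g)).

Lemma fold_adjP (J : nat -> nat) (u v : nat) :
  reflect (exists g, (u + J g = g /\ v.+1 = g + J g) \/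
                     (v + J g = g /\ u.+1 = g + J g))
          (fold_adj J u v).
Proof.
apply: (iffP orP) => [|[g Hg]].
  by case=> /andP[/eqP h1 /eqP h2]; exists (u + v).+1./2; [left | right].
have gE : (u + v).+1./2 = g by lia.
rewrite !gE; case: Hg => -[h1 h2]; [left | right]; apply/andP; split; apply/eqP => //.
Qed.

Lemma fold_adjC (J : nat -> nat) (u v : nat) : fold_adj J u v = fold_adj J v u.
Proof. by rewrite /fold_adj (addnC v u) orbC. Qed.

Lemma fold_adj_crease {J : nat -> nat} {g u v : nat} :
  u + J g = g -> v.+1 = g + J g -> fold_adj J u v.
Proof. by move=> h1 h2; apply/fold_adjP; exists g; left. Qed.

Definition fold_graph (n : nat) (J : nat -> nat) : rel 'I_n :=
  fun u v => fold_adj J u v.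

(** The last clause keeps each of two creases out of the open reach of the other; the reaches
    themselves may overlap between them. *)
Definition folding (n : nat) (J : nat -> nat) : Prop :=
  [/\ forall g, 0 < J g,
      forall g, 1 < J g -> J g <= g /\ g + J g <= n
    & forall g h, 1 < J g -> 1 < J h -> g < h -> g + J g <= h /\ g + J h <= h].

Lemma graph_iso_sym {V W : finType} {e : rel V} {e' : rel W} :
  graph_iso e e' -> graph_iso e' e.
Proof.
case=> f [g fK gK] fE; exists g; first by exists f.
by move=> x y; rewrite fE !gK.
Qed.

Lemma graph_iso_trans {U V W : finType} {d : rel U} {e : rel V} {f : rel W} :
  graph_iso d e -> graph_iso e f -> graph_iso d f.
Proof.
case=> i bi iE [j bj jE]; exists (j \o i); first exact: bij_comp.
by move=> x y; rewrite iE jE.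
Qed.

(** Such a list need not be exhaustive: its length is a lower bound for the degree of [z]. *)
Definition neighbours {V : finType} (e : rel V) (z : V) (s : seq V) : bool :=
  uniq s && all (e z) s.

Definition one_branch {V : finType} (e : rel V) : Prop :=
  [/\ exists z s, size s = 3 /\ neighbours e z s,
      forall z z' s s', size s = 3 -> size s' = 3 ->
        neighbours e z s -> neighbours e z' s' -> z = z'
    & forall z s, neighbours e z s -> size s <= 3].

Lemma one_branch_iso {V W : finType} {e : rel V} {e' : rel W} :
  graph_iso e e' -> one_branch e' -> one_branch e.
Proof.
case=> f bf fE; have injf := bij_inj bf.
have nE z s : neighbours e z s = neighbours e' (f z) (map f s).
  rewrite /neighbours map_inj_uniq // all_map; congr (_ && _).
  by apply: eq_all => x /=; rewrite fE.
case: bf => g fK gK [[z [s [sz zs]]] huniq hmax]; split.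
- exists (g z), (map g s); rewrite size_map nE -map_comp gK.
  by rewrite (eq_map (f := f \o g) (g := id)) ?map_id.
- move=> z1 z2 s1 s2 h1 h2; rewrite !nE => n1 n2.
  by apply: injf; apply: huniq n1 n2; rewrite size_map.
- by move=> z1 s1; rewrite nE => /hmax; rewrite size_map.
Qed.

Definition sum_pos {s t : nat} (z : 'I_s + 'I_t) : nat :=
  match z with inl i => i | inr j => s + j end.

Lemma sum_pos_inj (s t : nat) : injective (@sum_pos s t).
Proof.
move=> [i|i] [j|j] //= h.
- by congr inl; apply: val_inj.
- by have := ltn_ord i; lia.
- by have := ltn_ord j; lia.
- by congr inr; apply: val_inj => /=; lia.
Qed.

Lemma cH_adj_pos {s t a : nat} {z w : 'I_s + 'I_t} :
  0 < a ->
  cH_adj a z w ->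
  [\/ (sum_pos z).+1 = sum_pos w /\ (sum_pos z).+1 <> s,
      (sum_pos w).+1 = sum_pos z /\ (sum_pos w).+1 <> s,
      (sum_pos z).+1 = a /\ sum_pos w = s |
      (sum_pos w).+1 = a /\ sum_pos z = s].
Proof.
move=> a0; case: z w => [i|i] [j|j] /=; rewrite /path_adj.
- have := ltn_ord i; have := ltn_ord j => ? ? /orP[] h; [apply: Or41|apply: Or42]; lia.
- by case/andP=> ? ?; apply: Or43; lia.
- by case/andP=> ? ?; apply: Or44; lia.
- by case/orP=> ?; [apply: Or41|apply: Or42]; lia.
Qed.

Lemma cH_branch {s t a : nat} {z : 'I_s + 'I_t} {l : seq ('I_s + 'I_t)} :
  1 < a < s -> neighbours (cH_adj a) z l -> 2 < size l ->
  (sum_pos z).+1 = a /\ size l = 3.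
Proof.
move=> ha /andP[ul /allP el] sl; have a0 : 0 < a by lia.
have sub r : {in l, forall w, sum_pos w \in r} -> size l <= size r.
  move=> hr; rewrite -(size_map sum_pos); apply: uniq_leq_size.
    by rewrite (map_inj_uniq (@sum_pos_inj s t)).
  by move=> _ /mapP[w /hr wr ->].
have za : (sum_pos z).+1 = a.
  apply/eqP; apply: contraLR sl => za; rewrite -leqNgt.
  (* Neighbours of a vertex other than [u_a] sit at the two adjacent positions, except that [v_1],
     at position [s], has [u_a], at position [a - 1], in place of its predecessor. *)
  apply: (sub [:: (if sum_pos z == s then a.-1 else (sum_pos z).-1); (sum_pos z).+1]).
  move=> w /el /(cH_adj_pos a0); rewrite !inE.
  by case: (sum_pos z =P s) => zs [] []; lia.
split=> //; apply/eqP; rewrite eqn_leq sl andbT.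
apply: (sub [:: a.-2; a; s]) => w /el /(cH_adj_pos a0); rewrite !inE.
by case=> [] []; lia.
Qed.

Lemma cH_one_branch (s t a : nat) :
  1 < a < s -> 1 <= t -> one_branch (@cH_adj s t a).
Proof.
move=> ha ht; split.
- have h0 : a.-2 < s by lia.
  have h1 : a.-1 < s by lia.
  have h2 : a < s by lia.
  exists (inl (Ordinal h1)), [:: inl (Ordinal h0); inl (Ordinal h2); inr (Ordinal ht)].
  split=> //; rewrite /neighbours -(map_inj_uniq (@sum_pos_inj s t)) /= /path_adj /= !inE.
  rewrite !andbT; lia.
- move=> z z' l l' sl sl' nl nl'; apply: (@sum_pos_inj s t).
  have [h _] := cH_branch ha nl ltac:(by rewrite sl).
  have [h' _] := cH_branch ha nl' ltac:(by rewrite sl').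
  by lia.
- move=> z l nl; rewrite leqNgt; apply/negP => sl.
  by have [_ e] := cH_branch ha nl (ltnW sl); move: sl; rewrite e.
Qed.

(* Creases at the ends of [m] rows of width [x] followed by [k] rows of width
   [y]; the fold between the two blocks has radius [x]. *)
Definition block_fold (m x k y g : nat) : nat :=
  if 0 < g < m * x + k * y then
    if g <= m * x then (if x %| g then x else 1)
    else (if y %| g - m * x then y else 1)
  else 1.

(** Boundaries between rows: a fold edge whose reach stops at one of them ends at the end of a row,
    any other ends inside a row and creates a branch. *)
Definition row_end (n : nat) (J : nat -> nat) (g : nat) : Prop :=
  [\/ g = 0, g = n | 1 < J g].

Lemma row_endPn {n J g} : ~ row_end n J g -> [/\ g <> 0, g <> n & J g <= 1].
Proof.
move=> h; split; [by move=> e; apply: h; constructor 1|by move=> e; apply: h; constructor 2|].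
by rewrite leqNgt; apply/negP => e; apply: h; constructor 3.
Qed.

Lemma row_end_dec n J g : row_end n J g \/ ~ row_end n J g.
Proof.
have [->|g0] := eqVneq g 0; first by left; constructor 1.
have [->|gn] := eqVneq g n; first by left; constructor 2.
have [h|h] := ltnP 1 (J g); first by left; constructor 3.
by right; case; lia.
Qed.

Lemma fold_graph_ext {n J J'} :
  (forall g, 0 < g < n -> J g = J' g) -> (forall g, 0 < J g) -> (forall g, 0 < J' g) ->
  fold_graph n J =2 fold_graph n J'.
Proof.
move=> eJ J0 J0' u v; have := ltn_ord u; have := ltn_ord v => hv hu.
apply/fold_adjP/fold_adjP => -[g hg]; exists g; move: (J0 g) (J0' g).
  by have eg := eJ g ltac:(by move: (J0 g); lia); rewrite -eg.
by have eg := eJ g ltac:(by move: (J0' g); lia); rewrite eg.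
Qed.

(** Apart from the right reach of [f], every reach stops at a row boundary, which forces consecutive
    rows to have equal width. The width is therefore [J f] everywhere left of [f], and constant
    again right of [f], where it is larger because the reach of [f] stops inside a row. *)
Lemma folding_right_blocks {n J f} :
  folding n J -> 1 < J f -> ~ row_end n J (f + J f) ->
  (forall g, 1 < J g -> row_end n J (g - J g)) ->
  (forall g, 1 < J g -> g <> f -> row_end n J (g + J g)) ->
  exists m k y, [/\ 0 < m, 0 < k, J f < y, n = m * J f + k * y
    & forall g, 0 < g < n -> J g = block_fold m (J f) k y g].
Proof.
move=> [J0 Jbnd Jsep] Jf /row_endPn[_ fn fJ] Hl Hr; set x := J f in Jf fn fJ *.
have [fx fnx] := Jbnd _ Jf; rewrite -/x in fx fnx.
(* Induction on the distance to [f]: the left reach of the crease [g + J g] stops exactly at [g],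
   since a crease strictly between would lie in the reach of [g]. *)
have low1 d g : f - g < d -> g <= f -> 1 < J g -> J g = x.
  elim: d g => // d IH g hd gf Jg; have [-> //|gf'] := eqVneq g f.
  have [h1 h2] := Jsep g f Jg Jf ltac:(by lia).
  have Jh : 1 < J (g + J g).
    by case: (Hr g Jg ltac:(by lia)) => //; lia.
  have Eh := IH (g + J g) ltac:(by lia) h1 Jh.
  have [h3 h4] := Jsep g _ Jg Jh ltac:(by lia).
  case: (Hl _ Jh) => [||Jk]; [lia|lia|].
  have [hk|hk] := ltnP g (g + J g - J (g + J g)).
    by have := Jsep g _ Jg Jk hk; lia.
  by lia.
have low g : g <= f -> 1 < J g -> J g = x by exact: (low1 (f - g).+1).
have lowdvd1 d g : g < d -> g <= f -> 1 < J g -> x %| g.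
  elim: d g => // d IH g gd gf Jg; have Eg := low g gf Jg.
  have := Jbnd _ Jg => -[h1 h2]; rewrite -(subnK h1) Eg dvdn_addl //.
  move: (Hl _ Jg); rewrite Eg => -[-> //|h|Jh]; first by lia.
  by apply: IH => //; lia.
have lowdvd g : g <= f -> 1 < J g -> x %| g by apply: (lowdvd1 g.+1).
pose m := f %/ x; have fE : f = m * x by rewrite /m divnK //; apply: lowdvd.
have m0 : 0 < m by rewrite lt0n; apply/eqP => e; move: fE fx; rewrite e; lia.
have lowall d : d < m -> 1 < J ((m - d) * x).
  elim: d => [|d IH] dm; first by rewrite subn0 -fE.
  have {}IH := IH (ltnW dm).
  have hle : (m - d) * x <= m * x by rewrite leq_mul2r leq_subr orbT.
  have Ed : J ((m - d) * x) = x by apply: low => //; rewrite [leqRHS]fE.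
  have hd : (m - d.+1) * x = (m - d) * x - J ((m - d) * x).
    by rewrite Ed -{3}(mul1n x) -mulnBl; congr (_ * _); lia.
  rewrite hd; case: (Hl _ IH) => //; rewrite -hd; last by nia.
  by move/eqP; rewrite muln_eq0; lia.
have lowE g : 0 < g <= f -> J g = if x %| g then x else 1.
  case/andP=> g0 gf; case: ifP => [/dvdnP[q gE]|].
    apply: low => //; have qm : q <= m by move: gf; rewrite gE fE leq_pmul2r; lia.
    by have := lowall (m - q) ltac:(by nia); rewrite subKn // -gE.
  move=> xg; have [Jg|Jg] := ltnP 1 (J g); first by rewrite (lowdvd _ gf Jg) in xg.
  by have := J0 g; lia.
have [none|[h0 [fh0 Jh0]]] :
    (forall g, f < g -> J g = 1) \/ exists h, f < h /\ 1 < J h.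
- case E : [exists h : 'I_n, (f < h) && (1 < J h)].
    by case/existsP: E => h /andP[]; right; exists h.
  left=> g fg; apply/eqP; rewrite eqn_leq J0 andbT leqNgt; apply/negP => Jg.
  have gn : g < n by have := Jbnd _ Jg; lia.
  by move/existsP: E; apply; exists (Ordinal gn); rewrite /= fg.
(* With no crease beyond [f], the second block is a single row. *)
- exists m, 1, (n - f); split=> //; try lia; move=> g /andP[g0 gn].
  rewrite /block_fold mul1n -fE subnKC; last by lia.
  rewrite g0 gn /=; case: leqP => gf; first by rewrite lowE // g0.
  case: ifP; rewrite none // => /dvdnP[q]; case: q => [|q]; first by lia.
  by rewrite mulSn; lia.
have exh : exists h, (f < h) && (1 < J h) by exists h0; rewrite fh0.
case: (ex_minnP exh) => h /andP[fh Jh] hmin.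
have [fh1 fh2] := Jsep _ _ Jf Jh fh; rewrite -/x in fh1.
(* The left reach of [h] cannot pass the crease [f], and no crease lies strictly between them. *)
have hJ : h - J h = f.
  case: (Hl _ Jh) => [||Jk]; [lia|by have := Jbnd _ Jh; lia|].
  apply/eqP; rewrite eqn_leq; apply/andP; split; last by lia.
  by rewrite leqNgt; apply/negP => hk; have := hmin (h - J h); rewrite hk Jk; lia.
(* Equality would make [f + J f] the crease [h], hence a row end. *)
pose y := J h; have xy : x < y.
  by rewrite /y; move: Jh fJ; rewrite /x; have [<-|] := eqVneq (f + J f) h; lia.
(* Induction on the position: [g - J g] is a crease of radius [y], and its right reach stops at [g],
   as no crease lies strictly inside the reach of [g]. *)
have high1 d g : g < d -> f < g -> 1 < J g -> J g = y /\ y %| g - f.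
  elim: d g => // d IH g gd fg Jg; have [-> |gh] := eqVneq g h.
    by split=> //; rewrite (_ : h - f = y) // /y; lia.
  have hg : h < g by have := hmin g; rewrite fg Jg; lia.
  have [h1 h2] := Jsep _ _ Jh Jg hg.
  case: (Hl _ Jg) => [||Jk]; [lia|by have := Jbnd _ Jg; lia|].
  have [Ek Dk] := IH (g - J g) ltac:(by lia) ltac:(by lia) Jk.
  have [h3 h4] := Jsep _ _ Jk Jg ltac:(by lia).
  have EJ : J g = y.
    case: (Hr _ Jk ltac:(by lia)) => [||Jl]; [lia|by have := Jbnd _ Jg; lia|].
    have [hl|hl] := ltnP (g - J g + J (g - J g)) g; last by lia.
    by have := Jsep _ _ Jl Jg hl; lia.
  split=> //; rewrite (_ : g - f = g - J g - f + y); last by lia.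
  by rewrite dvdn_addl.
have high g : f < g -> 1 < J g -> J g = y /\ y %| g - f by apply: (high1 g.+1).
have exg : exists g, (f < g) && (1 < J g) by exists h; rewrite fh.
have gbnd g : (f < g) && (1 < J g) -> g <= n by case/andP=> _ /Jbnd; lia.
case: (ex_maxnP exg gbnd) => w /andP[fw Jw] wmax.
have [Ew Dw] := high _ fw Jw.
(* Beyond the last crease [w] the only row end left is [n]. *)
have nE : n = w + y.
  case: (Hr _ Jw ltac:(by lia)); rewrite Ew //; first by lia.
  by move=> Jz; have := wmax (w + y); rewrite Jz; lia.
have Dn : y %| n - f by rewrite (_ : n - f = w - f + y) ?dvdn_addl //; lia.
pose k := (n - f) %/ y; have kE : n = f + k * y by rewrite /k divnK //; lia.
have highall q : f + q.+1 * y < n -> 1 < J (f + q.+1 * y).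
  elim: q => [|q IH] hq; first by rewrite mul1n (_ : f + y = h) // /y; lia.
  have {}IH := IH ltac:(by move: hq; rewrite !mulSn; lia).
  have [Eq _] := high (f + q.+1 * y) ltac:(by rewrite mulSn; lia) IH.
  have e : f + q.+2 * y = f + q.+1 * y + J (f + q.+1 * y) by rewrite Eq !mulSn; lia.
  case: (Hr _ IH ltac:(by rewrite mulSn; lia)); rewrite -e //; first by rewrite mulSn; lia.
  by lia.
exists m, k, y; split=> //; [|by rewrite -fE|].
  by rewrite lt0n; apply/eqP => e; move: kE; rewrite e; lia.
move=> g /andP[g0 gn]; rewrite /block_fold -fE -kE g0 gn /=.
case: leqP => gf; first by rewrite lowE // g0.
have [Jg|Jg] := ltnP 1 (J g); first by have [-> ->] := high _ gf Jg.
case: ifP; last by have := J0 g; lia.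
case/dvdnP=> [[|q] qE]; first by lia.
have gE : g = f + q.+1 * y by lia.
by have := highall q; rewrite -gE; lia.
Qed.

Lemma folding_gap {n J g h} :
  folding n J -> 1 < J g -> g - J g < h < g + J g -> h <> g -> J h = 1.
Proof.
move=> [J0 Jbnd Jsep] Jg gh hg; have := J0 h; case: (ltnP 1 (J h)) => Jh Jh0; last by lia.
have [lt|lt] := ltnP g h; first by have := Jsep _ _ Jg Jh lt; lia.
by have := Jsep _ _ Jh Jg ltac:(by lia); lia.
Qed.

(** Position [v = g - J g] keeps both its path edges: [v] is no row end, and [v + 1] lies inside the
    reach of [g]. The fold edge at [g] is a third one. *)
Lemma neighbours_left_event {n J g} :
  folding n J -> 1 < J g -> ~ row_end n J (g - J g) ->
  exists v a b c : 'I_n, [/\ v + J g = g, a.+1 = v, b = v.+1 :> nat, c.+1 = g + J g &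
    all (fold_graph n J v) [:: a; b; c]].
Proof.
move=> FJ Jg /row_endPn[g0 gn gJ]; have [J0 /(_ _ Jg)[h1 h2] _] := FJ.
have E1 : J (g - J g) = 1 by have := J0 (g - J g); lia.
have E2 : J (g - J g).+1 = 1 by apply: (folding_gap FJ Jg); lia.
have hv : g - J g < n by lia.
have ha : (g - J g).-1 < n by lia.
have hb : (g - J g).+1 < n by lia.
have hc : (g + J g).-1 < n by lia.
exists (Ordinal hv), (Ordinal ha), (Ordinal hb), (Ordinal hc).
split; rewrite /= ?andbT /fold_graph /=; try lia; apply/and3P; split.
- by rewrite fold_adjC; apply: (@fold_adj_crease _ (g - J g)); lia.
- by apply: (@fold_adj_crease _ (g - J g).+1); lia.
- by apply: (@fold_adj_crease _ g); lia.
Qed.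

Lemma neighbours_right_event {n J g} :
  folding n J -> 1 < J g -> ~ row_end n J (g + J g) ->
  exists v a b c : 'I_n, [/\ v.+1 = g + J g, a.+1 = v, b = v.+1 :> nat, c + J g = g &
    all (fold_graph n J v) [:: a; b; c]].
Proof.
move=> FJ Jg /row_endPn[g0 gn gJ]; have [J0 /(_ _ Jg)[h1 h2] _] := FJ.
have E1 : J (g + J g) = 1 by have := J0 (g + J g); lia.
have E2 : J (g + J g).-1 = 1 by apply: (folding_gap FJ Jg); lia.
have hv : (g + J g).-1 < n by lia.
have ha : (g + J g).-2 < n by lia.
have hb : g + J g < n by lia.
have hc : g - J g < n by lia.
exists (Ordinal hv), (Ordinal ha), (Ordinal hb), (Ordinal hc).
split; rewrite /= ?andbT /fold_graph /=; try lia; apply/and3P; split.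
- by rewrite fold_adjC; apply: (@fold_adj_crease _ (g + J g).-1); lia.
- by apply: (@fold_adj_crease _ (g + J g)); lia.
- by rewrite fold_adjC; apply: (@fold_adj_crease _ g); lia.
Qed.

Lemma uniq_val {n : nat} (l : seq 'I_n) : uniq l = uniq (map val l).
Proof. by rewrite map_inj_uniq //; exact: val_inj. Qed.

Lemma branch_event {n J} {v a b c : 'I_n} :
  folding n J -> neighbours (fold_graph n J) v [:: a; b; c] ->
  exists2 g, 1 < J g & ~ row_end n J (g - J g) \/ ~ row_end n J (g + J g).
Proof.
move=> FJ /andP[]; rewrite uniq_val /= !inE negb_or !andbT.
case/andP=> /andP[ab ac] bc /and3P[va vb vc]; have [J0 Jbnd Jsep] := FJ.
(* The left path edge of [v] and the fold edge for which [v] is a left end can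
   coexist only at an interior fold end, and symmetrically on the right; two of
   three neighbours fall in the same class. *)
pose K1 (w : nat) := (w.+1 = v /\ J v = 1) \/
  exists g, [/\ 1 < J g, v + J g = g & w.+1 = g + J g].
pose K2 (w : nat) := (w = v.+1 /\ J w = 1) \/
  exists g, [/\ 1 < J g, w + J g = g & v.+1 = g + J g].
have K w : fold_adj J v w -> K1 w \/ K2 w.
  case/fold_adjP=> g [] [h1 h2]; have [Jg|Jg] := ltnP 1 (J g).
  - by left; right; exists g.
  - have Eg : J g = 1 by have := J0 g; lia.
    by right; left; rewrite (_ : w = g); lia.
  - by right; right; exists g.
  - have Eg : J g = 1 by have := J0 g; lia.
    by left; left; rewrite (_ : nat_of_ord v = g); lia.
have vn := ltn_ord v.
have mixL w g : w.+1 = v -> J v = 1 -> 1 < J g -> v + J g = g -> ~ row_end n J (g - J g).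
  by move=> h1 h2 h3 h4; rewrite (_ : g - J g = v); [case|]; lia.
have mixR w g : w < n -> w = v.+1 -> J w = 1 ->
    1 < J g -> v.+1 = g + J g -> ~ row_end n J (g + J g).
  by move=> wn h1 h2 h3 h4; rewrite -h4 -h1; case; lia.
have K1P w w' : w != w' -> K1 w -> K1 w' ->
    exists2 g, 1 < J g & ~ row_end n J (g - J g) \/ ~ row_end n J (g + J g).
  move=> ww' [[h1 h2]|[g [h1 h2 h3]]] [[h1' h2']|[g' [h1' h2' h3']]]; try lia.
  - by exists g' => //; left; exact: (mixL w).
  - by exists g => //; left; exact: (mixL w').
  - have [gg|gg|gg] := ltngtP g g'; first by have := Jsep _ _ h1 h1' gg; lia.
      by have := Jsep _ _ h1' h1 gg; lia.
    by move: h3 h3'; rewrite gg; lia.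
have K2P w w' : w < n -> w' < n -> w != w' -> K2 w -> K2 w' ->
    exists2 g, 1 < J g & ~ row_end n J (g - J g) \/ ~ row_end n J (g + J g).
  move=> wn wn' ww' [[h1 h2]|[g [h1 h2 h3]]] [[h1' h2']|[g' [h1' h2' h3']]]; try lia.
  - by exists g' => //; right; exact: (mixR w).
  - by exists g => //; right; exact: (mixR w').
  - have [gg|gg|gg] := ltngtP g g'; first by have := Jsep _ _ h1 h1' gg; lia.
      by have := Jsep _ _ h1' h1 gg; lia.
    by move: h2 h2'; rewrite gg; lia.
by case: (K _ va) => ka; case: (K _ vb) => kb; case: (K _ vc) => kc;
  first [exact: (K1P a b)|exact: (K1P a c)|exact: (K1P b c)|
         exact: (K2P a b)|exact: (K2P a c)|exact: (K2P b c)].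
Qed.

(* Truncation is harmless: every folding has [J 0 = 1]. *)
Definition rev_fold (n : nat) (J : nat -> nat) (g : nat) : nat := J (n - g).

Lemma folding_rev {n J} : folding n J -> folding n (rev_fold n J).
Proof.
move=> [J0 Jbnd Jsep]; split=> [g|g Jg|g h Jg Jh gh]; rewrite /rev_fold.
- exact: J0.
- by have := Jbnd _ Jg; rewrite /rev_fold in Jg *; lia.
- have := Jbnd _ Jg; have := Jbnd _ Jh; rewrite /rev_fold in Jg Jh * => h1 h2.
  by have := Jsep _ _ Jh Jg ltac:(by lia); lia.
Qed.

Lemma fold_graph_rev {n J} : folding n J ->
  graph_iso (fold_graph n J) (fold_graph n (rev_fold n J)).
Proof.
move=> [J0 _ _]; exists (@rev_ord n); first by exists (@rev_ord n); exact: rev_ordK.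
move=> u v; have := ltn_ord u; have := ltn_ord v => hv hu; rewrite /fold_graph /=.
apply/fold_adjP/fold_adjP => -[g hg]; exists (n - g); move: hg; rewrite /rev_fold.
  by have [gn|gn] := leqP g n; [rewrite subKn // |have := J0 g]; lia.
by have := J0 (n - g); lia.
Qed.

Lemma row_end_rev {n J g} : g <= n -> row_end n (rev_fold n J) g -> row_end n J (n - g).
Proof. by move=> gn; case=> [->|->|h]; [constructor 2; lia|constructor 1; lia|constructor 3]. Qed.

(** Another fold edge ending inside a row would again produce a branch vertex, which by uniqueness
    is [v]; both ways in which this could happen are refuted. *)
Lemma folding_blocks_right {n J f} :
  folding n J -> one_branch (fold_graph n J) -> 1 < J f -> ~ row_end n J (f + J f) ->
  exists m k y, [/\ 0 < m, 0 < k, J f < y, n = m * J f + k * y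
    & fold_graph n J =2 fold_graph n (block_fold m (J f) k y)].
Proof.
move=> FJ [_ buniq bmax] Jf fe.
have [v [a [b [c [h1 h2 h3 h4 vn]]]]] := neighbours_right_event FJ Jf fe.
have [J0 Jbnd Jsep] := FJ.
have nv : neighbours (fold_graph n J) v [:: a; b; c].
  by rewrite /neighbours vn uniq_val /= !inE; lia.
have Hl g : 1 < J g -> row_end n J (g - J g).
  move=> Jg; case: (row_end_dec n J (g - J g)) => // ge.
  have [v' [a' [b' [c' [h1' h2' h3' h4' vn']]]]] := neighbours_left_event FJ Jg ge.
  have nv' : neighbours (fold_graph n J) v' [:: a'; b'; c'].
    by rewrite /neighbours vn' uniq_val /= !inE; lia.
  have vv : v = v' := buniq _ _ [:: a; b; c] [:: a'; b'; c'] erefl erefl nv nv'.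
  (* The far end [c'] of the second fold edge is a fourth neighbour of [v]. *)
  suff: neighbours (fold_graph n J) v [:: a; b; c; c'] by move/bmax.
  apply/andP; split.
    by move: h1' h2' h3'; rewrite uniq_val /= !inE -vv; lia.
  move: vn' vn; rewrite -vv /= => /and4P[_ _ -> _] /and4P[-> -> -> _] //.
have Hr g : 1 < J g -> g <> f -> row_end n J (g + J g).
  move=> Jg gf; case: (row_end_dec n J (g + J g)) => // ge.
  have [v' [a' [b' [c' [h1' h2' h3' h4' vn']]]]] := neighbours_right_event FJ Jg ge.
  have nv' : neighbours (fold_graph n J) v' [:: a'; b'; c'].
    by rewrite /neighbours vn' uniq_val /= !inE; lia.
  have vv : v = v' := buniq _ _ [:: a; b; c] [:: a'; b'; c'] erefl erefl nv nv'.
  (* Two right reaches stopping at the same place contradict the separation of creases. *)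
  rewrite -vv in h1'; have [lt|lt|//] := ltngtP g f.
    by have := Jsep _ _ Jg Jf lt; lia.
  by have := Jsep _ _ Jf Jg lt; lia.
have [m [k [y [m0 k0 xy nE EJ]]]] := folding_right_blocks FJ Jf fe Hl Hr.
exists m, k, y; split=> //; apply: fold_graph_ext => // g.
by rewrite /block_fold; case: ifP => // _; case: ifP => // _; case: ifP => // _; lia.
Qed.

Lemma folding_blocks {n J} :
  folding n J -> one_branch (fold_graph n J) ->
  exists m x k y, [/\ 0 < m, 0 < k, 1 < x < y, n = m * x + k * y
    & graph_iso (fold_graph n J) (fold_graph n (block_fold m x k y))].
Proof.
move=> FJ BJ; have [[v [s [s3 vs]]] _ _] := BJ.
case: s s3 vs => [|a [|b [|c []]]] // _ vs.
have iso_ext J1 J2 : fold_graph n J1 =2 fold_graph n J2 ->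
    graph_iso (fold_graph n J1) (fold_graph n J2).
  by move=> e; exists id; [exists id|].
have [f Jf [fe|fe]] := branch_event FJ vs; last first.
  have [m [k [y [m0 k0 xy nE e]]]] := folding_blocks_right FJ BJ Jf fe.
  by exists m, (J f), k, y; split=> //; [rewrite Jf | apply: iso_ext].
(* Reversing the path turns an interior left end into an interior right end. *)
have FR := folding_rev FJ; have iR := fold_graph_rev FJ.
have BR := one_branch_iso (graph_iso_sym iR) BJ.
have [_ /(_ _ Jf)[h1 h2] _] := FJ.
have Ef : rev_fold n J (n - f) = J f by rewrite /rev_fold subKn //; lia.
have fe' : ~ row_end n (rev_fold n J) (n - f + rev_fold n J (n - f)).
  rewrite Ef => /row_end_rev h; apply: fe.
  by rewrite (_ : f - J f = n - (n - f + J f)); [apply: h|]; lia.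
have Jf' : 1 < rev_fold n J (n - f) by rewrite Ef.
have [m [k [y]]] := folding_blocks_right FR BR Jf' fe'.
rewrite Ef => -[m0 k0 xy nE e]; exists m, (J f), k, y; split=> //; first by rewrite Jf.
by apply: graph_iso_trans iR _; apply: iso_ext.
Qed.

(** * The tree of a block folding *)

(** With [i] in row [i %/ y] and column [i %% y], this reflects each row; [stack_rows] reverses the
    order of the rows and keeps the columns. *)
Definition reverse_rows (y i : nat) : nat := i %/ y * y + (y - 1 - i %% y).

Definition stack_rows (m x j : nat) : nat := (m - 1 - j %/ x) * x + j %% x.

Lemma reverse_rowsE (y q o : nat) : o < y -> reverse_rows y (q * y + o) = q * y + (y - 1 - o).
Proof.
move=> oy; have y0 : 0 < y by lia.
by rewrite /reverse_rows divnMDl // modnMDl divn_small // modn_small // addn0.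
Qed.

Lemma stack_rowsE (m x q o : nat) : o < x -> stack_rows m x (q * x + o) = (m - 1 - q) * x + o.
Proof.
move=> ox; have x0 : 0 < x by lia.
by rewrite /stack_rows divnMDl // modnMDl divn_small // modn_small // addn0.
Qed.

Lemma row_coord {k y i : nat} : i < k * y ->
  exists q o, [/\ q < k, o < y & i = q * y + o].
Proof.
case: y => [|y]; first by rewrite muln0.
move=> iky; exists (i %/ y.+1), (i %% y.+1); split; last exact: divn_eq.
  by rewrite ltn_divLR.
exact: ltn_pmod.
Qed.

Lemma row_bound {k y q o : nat} : q < k -> o < y -> q * y + o < k * y.
Proof.
move=> qk oy; have : q.+1 * y <= k * y by rewrite leq_mul2r qk orbT.
by rewrite mulSn; lia.
Qed.

Lemma reverse_rows_lt {k y i : nat} : i < k * y -> reverse_rows y i < k * y.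
Proof.
by case/row_coord=> q [o [qk oy ->]]; rewrite reverse_rowsE //; apply: row_bound; lia.
Qed.

Lemma reverse_rowsK {k y i : nat} : i < k * y -> reverse_rows y (reverse_rows y i) = i.
Proof.
by case/row_coord=> q [o [qk oy ->]]; rewrite !reverse_rowsE; lia.
Qed.

Lemma stack_rows_lt {m x i : nat} : i < m * x -> stack_rows m x i < m * x.
Proof.
by case/row_coord=> q [o [qk oy ->]]; rewrite stack_rowsE //; apply: row_bound; lia.
Qed.

Lemma stack_rowsK {m x i : nat} : i < m * x -> stack_rows m x (stack_rows m x i) = i.
Proof.
case/row_coord=> q [o [qk oy ->]]; rewrite !stack_rowsE //.
by congr (_ * _ + _); lia.
Qed.

Lemma row_dvdn {x q o : nat} : o < x -> (x %| q * x + o) = (o == 0).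
Proof.
by move=> ox; rewrite dvdn_addr ?dvdn_mull //; case: o ox => [|o] ox; rewrite ?dvdn0 ?gtnNdvd.
Qed.

Lemma block_fold_low {m x k y q o : nat} :
  q < m -> o < x -> 0 < q * x + o -> block_fold m x k y (q * x + o) = if o == 0 then x else 1.
Proof.
move=> qm ox h; have := row_bound qm ox => lt.
by rewrite /block_fold h ltn_addr // ltnW // row_dvdn.
Qed.

Lemma block_fold_mid {m x k y : nat} :
  0 < m * x -> 0 < k * y -> block_fold m x k y (m * x) = x.
Proof. by move=> h h'; rewrite /block_fold h leqnn dvdn_mull // -{1}[m * x]addn0 ltn_add2l h'. Qed.

Lemma block_fold_high {m x k y q o : nat} :
  q < k -> o < y -> 0 < q * y + o ->
  block_fold m x k y (m * x + (q * y + o)) = if o == 0 then y else 1.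
Proof.
move=> qk oy h; have := row_bound qk oy => lt; rewrite /block_fold ltn_add2l lt.
rewrite (_ : 0 < m * x + (q * y + o)); last by lia.
by rewrite leqNgt -{1}[m * x]addn0 ltn_add2l h /= addKn row_dvdn.
Qed.

Lemma block_fold_gt0 (m x k y g : nat) : 0 < x -> 0 < y -> 0 < block_fold m x k y g.
Proof. by move=> x0 y0; rewrite /block_fold; do 3?case: ifP. Qed.

(* In this tree the path [u] runs through each row of the second block backwards,
   and [v] runs through the rows of the first block from the last one to the
   first. *)
Lemma block_fold_iso (n m x k y : nat) :
  0 < m -> 0 < k -> 0 < x <= y -> n = m * x + k * y ->
  graph_iso (fold_graph n (block_fold m x k y)) (@cH_adj (k * y) (m * x) (y - x + 1)).
Proof.
move=> m0 k0 /andP[x0 xy] nE; have y0 : 0 < y by lia.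
have mx0 : 0 < m * x by rewrite muln_gt0 m0.
have ky0 : 0 < k * y by rewrite muln_gt0 k0.
apply: graph_iso_sym.
have lt1 (i : 'I_(k * y)) : m * x + reverse_rows y i < n.
  by rewrite nE ltn_add2l; apply: reverse_rows_lt.
have lt2 (j : 'I_(m * x)) : stack_rows m x j < n.
  by rewrite nE; have := stack_rows_lt (ltn_ord j); lia.
pose f (z : 'I_(k * y) + 'I_(m * x)) : 'I_n :=
  match z with inl i => Ordinal (lt1 i) | inr j => Ordinal (lt2 j) end.
have f1 q o : q < k -> o < y -> exists i : 'I_(k * y), i = q * y + o :> nat /\
    f (inl i) = m * x + (q * y + (y - 1 - o)) :> nat.
  by move=> qk oy; exists (Ordinal (row_bound qk oy)); rewrite /= reverse_rowsE.
have f2 q o : q < m -> o < x -> exists j : 'I_(m * x), j = q * x + o :> nat /\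
    f (inr j) = (m - 1 - q) * x + o :> nat.
  by move=> qk oy; exists (Ordinal (row_bound qk oy)); rewrite /= stack_rowsE.
have finj : injective f.
  move=> [i|i] [j|j] /(congr1 val) /= h.
  - congr inl; apply: val_inj; rewrite /= -(reverse_rowsK (ltn_ord i)) -(reverse_rowsK (ltn_ord j)).
    by congr reverse_rows; lia.
  - by have := stack_rows_lt (ltn_ord j); lia.
  - by have := stack_rows_lt (ltn_ord i); lia.
  - congr inr; apply: val_inj; rewrite /= -(stack_rowsK (ltn_ord i)) -(stack_rowsK (ltn_ord j)).
    by rewrite h.
exists f; first by apply: inj_card_bij => //; rewrite card_sum !card_ord nE; lia.
have cHC z w : cH_adj (y - x + 1) z w = cH_adj (y - x + 1) w z.
  by case: z w => [i|i] [j|j] //=; rewrite /path_adj orbC.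
have sub1 (i i' : 'I_(k * y)) : i.+1 = i' ->
    fold_graph n (block_fold m x k y) (f (inl i)) (f (inl i')).
  have [q [o [qk oy iE]]] := row_coord (ltn_ord i) => ii'.
  rewrite /fold_graph /= -ii' iE reverse_rowsE //.
  have [oy'|oy'] := eqVneq o.+1 y.
    (* At the end of a row, [u] follows the fold edge of radius [y] to the far end of the next
       row. *)
    have qk' : q.+1 < k.
      by have := ltn_ord i'; rewrite -ii' iE (_ : (q * y + o).+1 = q.+1 * y) ?ltn_mul2r ?mulSn; lia.
    rewrite (_ : (q * y + o).+1 = q.+1 * y + 0); last by rewrite mulSn; lia.
    rewrite reverse_rowsE //.
    have := @block_fold_high m x k y q.+1 0 qk' y0; rewrite addn0 mulSn => e.
    by apply: (fold_adj_crease (g := m * x + q.+1 * y)); rewrite mulSn e //=; lia.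
  rewrite -addnS reverse_rowsE; last by lia.
  rewrite fold_adjC.
  have := @block_fold_high m x k y q (y - 1 - o) qk.
  rewrite [_ == 0](_ : _ = false); last by lia.
  move=> e; apply: (fold_adj_crease (g := m * x + (q * y + (y - 1 - o)))); rewrite e; lia.
have sub2 (j j' : 'I_(m * x)) : j.+1 = j' ->
    fold_graph n (block_fold m x k y) (f (inr j)) (f (inr j')).
  have [q [o [qk oy iE]]] := row_coord (ltn_ord j) => ii'.
  rewrite /fold_graph /= -ii' iE stack_rowsE //.
  have [oy'|oy'] := eqVneq o.+1 x.
    have qk' : q.+1 < m.
      by have := ltn_ord j'; rewrite -ii' iE (_ : (q * x + o).+1 = q.+1 * x) ?ltn_mul2r ?mulSn; lia.
    rewrite (_ : (q * x + o).+1 = q.+1 * x + 0); last by rewrite mulSn; lia.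
    rewrite stack_rowsE // fold_adjC.
    (* [v] passes from the last column of row [d + 1] to the first column of row [d]; naming [d]
       removes the truncated subtractions. *)
    have [d dE] : exists d, m = q + d.+2 by exists (m - q.+2); lia.
    rewrite (_ : m - 1 - q.+1 = d) 1?(_ : m - 1 - q = d.+1); try lia.
    have := @block_fold_low m x k y d.+1 0; rewrite addn0 mulSn => e.
    by apply: (fold_adj_crease (g := d.+1 * x)); rewrite mulSn e //=; lia.
  rewrite -addnS stack_rowsE; last by lia.
  have := @block_fold_low m x k y (m - 1 - q) o.+1 => /= e.
  move: e; move: ((m - 1 - q) * x) => A e.
  by apply: (fold_adj_crease (g := A + o.+1)); rewrite e; lia.
have sub3 (i : 'I_(k * y)) (j : 'I_(m * x)) : i.+1 == y - x + 1 -> j == 0 :> nat ->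
    fold_graph n (block_fold m x k y) (f (inl i)) (f (inr j)).
  move=> /eqP iE /eqP jE; rewrite /fold_graph /= jE.
  (* The vertex [u_a] is at position [m * x + x - 1], the right end of the fold of radius [x]
     between the blocks. *)
  have -> : reverse_rows y i = x - 1.
    by rewrite (_ : nat_of_ord i = 0 * y + (y - x)) ?reverse_rowsE; lia.
  have -> : stack_rows m x 0 = m.-1 * x.
    by rewrite (_ : 0 = 0 * x + 0) // stack_rowsE // subn0 addn0 subn1.
  have mE : m * x = m.-1 * x + x by rewrite -mulSnr prednK.
  rewrite fold_adjC; apply: (fold_adj_crease (g := m * x)); rewrite block_fold_mid //; lia.
have sub z w : cH_adj (y - x + 1) z w -> fold_graph n (block_fold m x k y) (f z) (f w).
  case: z w => [i|i] [j|j] /=; rewrite /path_adj.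
  - by case/orP=> /eqP h; [|rewrite /fold_graph fold_adjC]; apply: sub1.
  - by case/andP; apply: sub3.
  - by case/andP=> ? ?; rewrite /fold_graph fold_adjC; apply: sub3.
  - by case/orP=> /eqP h; [|rewrite /fold_graph fold_adjC]; apply: sub2.
(* Conversely, the crease of an edge lies in the first block, in the second, or between them, and
   this locates both ends. *)
have sup (u v : 'I_n) g : u + block_fold m x k y g = g -> v.+1 = g + block_fold m x k y g ->
    exists z w, [/\ u = f z, v = f w & cH_adj (y - x + 1) z w].
  move=> uE vE; have J0 := @block_fold_gt0 m x k y g x0 y0.
  have gn : 0 < g < n by have := ltn_ord v; lia.
  have [gm|mg|gE] := ltngtP g (m * x).
  - have [q [o [qm ox gE]]] := row_coord gm.
    move: uE vE; rewrite gE block_fold_low //; last by lia.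
    case: (posnP o) => [o0|o0] uE vE.
      have [q' qE] : exists q', q = q'.+1.
        exists q.-1; rewrite prednK // lt0n; apply/eqP => e.
        by move: gn; rewrite gE e; lia.
      have [j [jE fj]] := f2 (m - 1 - q') 0 ltac:(by lia) x0.
      have [j' [jE' fj']] := f2 (m - 1 - q) (x - 1) ltac:(by lia) ltac:(by lia).
      exists (inr j), (inr j'); split.
      + apply: val_inj; rewrite /= in fj *; rewrite fj.
        by rewrite (_ : m - 1 - (m - 1 - q') = q'); move: uE; rewrite qE mulSn; lia.
      + apply: val_inj; rewrite /= in fj' *; rewrite fj'.
        by rewrite (_ : m - 1 - (m - 1 - q) = q); move: vE; lia.
      + rewrite /= /path_adj jE jE' (_ : m - 1 - q' = (m - 1 - q).+1); last by lia.
        by rewrite mulSn; lia.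
    have [j [jE fj]] := f2 (m - 1 - q) o.-1 ltac:(by lia) ltac:(by lia).
    have [j' [jE' fj']] := f2 (m - 1 - q) o ltac:(by lia) ltac:(by lia).
    rewrite (_ : m - 1 - (m - 1 - q) = q) in fj fj'; try lia.
    exists (inr j), (inr j'); split; [apply: val_inj|apply: val_inj|]; rewrite /=.
    + by rewrite /= in fj; rewrite fj; lia.
    + by rewrite /= in fj'; rewrite fj'; lia.
    + by rewrite /path_adj jE jE'; lia.
  - have [q [o [qk oy gE]]] := @row_coord k y (g - m * x) ltac:(by lia).
    have {}gE : g = m * x + (q * y + o) by lia.
    move: uE vE; rewrite gE block_fold_high //; last by lia.
    case: (posnP o) => [o0|o0] uE vE.
      have [q' qE] : exists q', q = q'.+1.
        exists q.-1; rewrite prednK // lt0n; apply/eqP => e.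
        by move: mg; rewrite gE e; lia.
      have [j [jE fj]] := f1 q' (y - 1) ltac:(by lia) ltac:(by lia).
      have [j' [jE' fj']] := f1 q 0 ltac:(by lia) ltac:(by lia).
      exists (inl j), (inl j'); split; [apply: val_inj|apply: val_inj|]; rewrite /=.
      + by rewrite /= in fj; rewrite fj; move: uE; rewrite qE mulSn; lia.
      + by rewrite /= in fj'; rewrite fj'; lia.
      + by rewrite /path_adj jE jE' qE mulSn; lia.
    have [j [jE fj]] := f1 q (y - o) ltac:(by lia) ltac:(by lia).
    have [j' [jE' fj']] := f1 q (y - 1 - o) ltac:(by lia) ltac:(by lia).
    exists (inl j), (inl j'); split; [apply: val_inj|apply: val_inj|]; rewrite /=.
    + by rewrite /= in fj; rewrite fj; lia.
    + by rewrite /= in fj'; rewrite fj'; lia.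
    + by rewrite /path_adj jE jE'; lia.
  - move: uE vE; rewrite gE block_fold_mid // => uE vE.
    have [j [jE fj]] := f2 0 0 m0 x0.
    have [i [iE fi]] := f1 0 (y - x) k0 ltac:(by lia).
    exists (inr j), (inl i); split; [apply: val_inj|apply: val_inj|]; rewrite /=.
    + rewrite /= in fj; rewrite fj; move: uE; have [d ->] : exists d, m = d.+1 by exists m.-1; lia.
      by rewrite mulSn subn1 subn0 /=; lia.
    + by rewrite /= in fi; rewrite fi; lia.
    + by rewrite iE jE; lia.
move=> z w; apply/idP/idP; first exact: sub.
case/fold_adjP=> g [] [h1 h2].
  have [z' [w' [/finj -> /finj -> ]]] := sup _ _ _ h1 h2; exact.
by have [z' [w' [/finj -> /finj -> ]]] := sup _ _ _ h1 h2; rewrite cHC.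
Qed.

Lemma block_fold_crease {m x k y g : nat} : 1 < block_fold m x k y g ->
  (exists q, [/\ 0 < q <= m, g = q * x & block_fold m x k y g = x]) \/
  (exists q, [/\ 0 < q < k, g = m * x + q * y & block_fold m x k y g = y]).
Proof.
rewrite /block_fold; case: ifP => // /andP[g0 gn]; case: (leqP g (m * x)) => gm; case: ifP => //.
  case/dvdnP=> q gE _; left; exists q; split=> //; apply/andP; split.
    by rewrite lt0n; apply/eqP => e; move: g0; rewrite gE e.
  case: (posnP x) gm => [x0|x0]; first by move: g0; rewrite gE x0 muln0.
  by rewrite gE leq_pmul2r.
case/dvdnP=> q gE y1; right; exists q; split=> //; last by lia.
apply/andP; split; first by rewrite lt0n; apply/eqP => e; move: gE; rewrite e; lia.
have : q * y < k * y by lia.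
by rewrite ltn_mul2r => /andP[].
Qed.

(** Within a block each reach is the distance to the next crease. The crease between the blocks
    takes the width [x], which fits into the second block because [x <= y]. *)
Lemma block_fold_folding (n m x k y : nat) :
  0 < k -> 0 < x <= y -> n = m * x + k * y -> folding n (block_fold m x k y).
Proof.
move=> k0 /andP[x0 xy] nE; have y0 : 0 < y by lia.
have low q : 0 < q <= m -> x <= q * x <= m * x.
  by case/andP=> q0 qm; rewrite leq_pmull // leq_mul2r qm orbT.
have high q : 0 < q < k -> y <= q * y /\ q * y + y <= k * y.
  by case/andP=> q0 qk; rewrite leq_pmull // -mulSnr leq_mul2r qk orbT.
have yk : y <= k * y by rewrite leq_pmull.
have gap z q r : q * z < r * z -> q * z + z <= r * z.
  by rewrite ltn_mul2r => /andP[_ qr]; rewrite -mulSnr leq_mul2r qr orbT.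
split=> [g|g|g h]; first exact: block_fold_gt0.
  by case/block_fold_crease=> -[q [hq -> ->]]; [have := low q hq|have := high q hq]; lia.
move=> /block_fold_crease Jg /block_fold_crease Jh.
case: Jg => -[q [hq -> ->]]; case: Jh => -[r [hr -> ->]] lt.
- by have := gap _ _ _ lt; lia.
- by have := low q hq; have := high r hr; lia.
- by have := low r hr; lia.
- by have := gap y q r ltac:(by lia); lia.
Qed.

(** * From embeddings to foldings *)

Definition fold_edges (n : nat) (J : nat -> nat) : {set {set 'I_n}} :=
  [set [set uv.1; uv.2] | uv : 'I_n * 'I_n & fold_adj J uv.1 uv.2].

Lemma set2_eq {T : finType} {a b c d : T} :
  [set a; b] = [set c; d] -> (a = c /\ b = d) \/ (a = d /\ b = c).
Proof.
move=> e; have : [/\ a \in [set c; d], b \in [set c; d], c \in [set a; b] & d \in [set a; b]].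
  by split; [rewrite -e|rewrite -e|rewrite e|rewrite e]; rewrite !inE eqxx ?orbT.
rewrite !inE => -[/orP[]/eqP ha /orP[]/eqP hb /orP[]/eqP hc /orP[]/eqP hd];
  first [by left; split; congruence | by right; split; congruence].
Qed.

Lemma fold_edgesP {n J} (A : {set 'I_n}) :
  reflect (exists u v : 'I_n, A = [set u; v] /\ fold_adj J u v) (A \in fold_edges n J).
Proof.
apply: (iffP imsetP) => [[[u v]]|[u [v [-> uv]]]]; last by exists (u, v); rewrite ?inE.
by rewrite inE /= => uv ->; exists u, v.
Qed.

Lemma mem_fold_edges {n J} (u v : 'I_n) :
  ([set u; v] \in fold_edges n J) = fold_adj J u v.
Proof.
apply/fold_edgesP/idP => [[a [b [/set2_eq[] [-> ->]]]] //|uv]; first by rewrite fold_adjC.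
by exists u, v.
Qed.

Lemma fold_edges_path (n : nat) : fold_edges n (fun=> 1) = path_edges n.
Proof.
apply/setP=> A; apply/fold_edgesP/imsetP => [[u [v [-> uv]]]|[[u v]]].
  exists (u, v) => //; rewrite inE /= /path_adj.
  by case/fold_adjP: uv => g; lia.
rewrite inE /= /path_adj => uv ->; exists u, v; split=> //.
by apply/fold_adjP; case/orP: uv => uv; [exists v|exists u]; lia.
Qed.

(** Since an edge determines its crease, changing the radius at one crease affects one edge only. *)
Lemma fold_edges_step {n : nat} {J J' : nat -> nat} {b1 b2 u v : 'I_n} :
  b2 = b1.+1 :> nat -> J b2 = 1 -> (forall g, g <> b2 :> nat -> J' g = J g) ->
  u + J' b2 = b2 -> v.+1 = b2 + J' b2 ->
  fold_edges n J' = [set u; v] |: (fold_edges n J :\ [set b1; b2]).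
Proof.
move=> b12 Jb J'E uE vE; apply/setP=> A; rewrite !inE.
apply/fold_edgesP/orP => [[c [d [-> /fold_adjP[g hg]]]]|].
  have [gb|gb] := eqVneq g b2.
    left; rewrite gb in hg; case: hg => -[h1 h2].
      have -> : c = u by apply: val_inj => /=; lia.
      have -> : d = v by apply: val_inj => /=; lia.
      by rewrite eqxx.
    have -> : c = v by apply: val_inj => /=; lia.
    have -> : d = u by apply: val_inj => /=; lia.
    by rewrite setUC.
  move/eqP in gb; right; apply/andP; split.
    apply/eqP => /set2_eq h; apply: gb.
    by case: h => -[e1 e2]; move: hg; rewrite e1 e2; lia.
  by rewrite mem_fold_edges; apply/fold_adjP; exists g; rewrite -J'E.
case=> [/eqP ->|/andP[neq /fold_edgesP[c [d [AE /fold_adjP[g hg]]]]]].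
  by exists u, v; split=> //; exact: fold_adj_crease uE vE.
exists c, d; split=> //; apply/fold_adjP; exists g; rewrite J'E // => gb.
case/eqP: neq; rewrite AE; rewrite gb Jb in hg; case: hg => -[h1 h2].
  have -> : c = b1 by apply: val_inj => /=; lia.
  by have -> : d = b2 by apply: val_inj => /=; lia.
have -> : c = b2 by apply: val_inj => /=; lia.
have -> : d = b1 by apply: val_inj => /=; lia.
by rewrite setUC.
Qed.

Lemma grid_adjP {k l : nat} (a b : 'I_k * 'I_l) :
  reflect ((a.1 = b.1 :> nat /\ (a.2.+1 = b.2 \/ b.2.+1 = a.2)) \/
           (a.2 = b.2 :> nat /\ (a.1.+1 = b.1 \/ b.1.+1 = a.1)))
          (grid_adj a b).
Proof.
rewrite /grid_adj /path_adj -!(inj_eq val_inj) /=.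
by apply: (iffP idP); lia.
Qed.

(** A change of direction would repeat a value two steps later, so the first step fixes the sign of
    all the others. *)
Lemma walk_line (f : nat -> nat) (b e : nat) :
  (forall i, b <= i < e -> f i.+1 = (f i).+1 \/ f i = (f i.+1).+1) ->
  (forall i, b <= i -> i.+2 <= e -> f i <> f i.+2) ->
  (forall i, b <= i <= e -> f i = f b + (i - b)) \/
  (forall i, b <= i <= e -> f i + (i - b) = f b).
Proof.
elim: e => [|e IH] fS fI; first by left=> i hi; rewrite (_ : i = b); lia.
have [eb|be] := ltnP e b; first by left=> i hi; rewrite (_ : i = b); lia.
have step i : b <= i <= e.+1 -> i = e.+1 \/ b <= i <= e by lia.
have [eb|eb] := eqVneq e b.
  have [h|h] := fS e ltac:(by lia); [left|right] => i /step[->|hi]; try (rewrite (_ : i = b); lia).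
    by rewrite -eb h; lia.
  by rewrite -eb h; lia.
have hS := fS e ltac:(by lia).
have hI := fI e.-1 ltac:(by lia) ltac:(by lia); rewrite prednK in hI; last by lia.
case: IH => [i hi|i h1 h2|h|h]; [by apply: fS; lia|by apply: fI; lia|left|right] => i /step[->|hi];
  try exact: h; have h1 := h e ltac:(by lia); have h2 := h e.-1 ltac:(by lia); lia.
Qed.

(** Transposing the grid reduces segments that lie in a column to segments that lie in a row. *)
Definition swap_embedding {n k l : nat} (p : 'I_n -> 'I_k * 'I_l) (i : 'I_n) : 'I_l * 'I_k :=
  ((p i).2, (p i).1).

Lemma grid_adj_swap {k l : nat} (a b : 'I_k * 'I_l) :
  grid_adj (a.2, a.1) (b.2, b.1) = grid_adj a b.
Proof. by rewrite /grid_adj /= orbC. Qed.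

Lemma embedding_swap {n k l : nat} {p : 'I_n -> 'I_k * 'I_l} :
  embedding p -> embedding (swap_embedding p).
Proof.
case=> pI pA; split=> [i j [e2 e1]|i j /pA]; last by rewrite grid_adj_swap.
by apply: pI; rewrite (surjective_pairing (p i)) e1 e2 -surjective_pairing.
Qed.

Lemma straight_swap {n k l : nat} (p : 'I_n -> 'I_k * 'I_l) b e :
  straight (swap_embedding p) b e <-> straight p b e.
Proof. by split; case=> h; [right|left|right|left]. Qed.

Lemma segment_swap {n k l : nat} {p : 'I_n -> 'I_k * 'I_l} {b e} :
  segment p b e -> segment (swap_embedding p) b e.
Proof.
case=> be st mx; split=> //; first exact/straight_swap.
by move=> b' e' h1 h2 /straight_swap; exact: mx.
Qed.

Lemma row_line {n k l : nat} {p : 'I_n -> 'I_k * 'I_l} {b e : 'I_n} :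
  embedding p -> (forall i : 'I_n, b <= i <= e -> (p i).1 = (p b).1) ->
  (forall i : 'I_n, b <= i <= e -> (p i).2 = (p b).2 + (i - b) :> nat) \/
  (forall i : 'I_n, b <= i <= e -> (p i).2 + (i - b) = (p b).2).
Proof.
(* The default value [b] of [insubd] is never met for indices up to [e]. *)
case=> pI pA pc; pose f i : nat := (p (insubd b i)).2.
have fE (i : 'I_n) : f i = (p i).2 by rewrite /f valKd.
have en := ltn_ord e.
have [| |h|h] := walk_line f b e; last 2 first.
- by left=> i hi; rewrite -!fE h.
- by right=> i hi; rewrite -!fE h.
- move=> i hi; have hi1 : i < n by lia. have hi2 : i.+1 < n by lia.
  have c1 := pc (Ordinal hi1) ltac:(by rewrite /=; lia).
  have c2 := pc (Ordinal hi2) ltac:(by rewrite /=; lia).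
  have /grid_adjP := pA (Ordinal hi1) (Ordinal hi2) ltac:(by rewrite /path_adj /= eqxx).
  by rewrite -(fE (Ordinal hi1)) -(fE (Ordinal hi2)) c1 c2 /=; lia.
- move=> i hi hi'; have hi1 : i < n by lia. have hi2 : i.+2 < n by lia.
  have c1 := pc (Ordinal hi1) ltac:(by rewrite /=; lia).
  have c2 := pc (Ordinal hi2) ltac:(by rewrite /=; lia).
  move=> e2; have := fE (Ordinal hi1); have := fE (Ordinal hi2); rewrite /= => f2 f1.
  have : Ordinal hi1 = Ordinal hi2.
    apply: pI; rewrite (surjective_pairing (p (Ordinal hi1)))
      (surjective_pairing (p (Ordinal hi2))).
    by congr (_, _); [rewrite c1 c2|apply: val_inj; rewrite /= -f1 -f2 e2].
  by move/(congr1 val) => /=; lia.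
Qed.

(** The edge [b1 b2] is perpendicular to both neighbouring segments, so these lie in adjacent rows
    and the grid edge [u v] runs along a column, as [b1 b2] does. Hence [u] and [v] are equally far
    from [b1] and [b2]. *)
Lemma fold_offset_row {n k l : nat} {p : 'I_n -> 'I_k * 'I_l} {b0 b1 b2 b3 u v : 'I_n} :
  embedding p -> segment p b0 b1 -> segment p b2 b3 -> b2 = b1.+1 :> nat ->
  (forall i : 'I_n, b0 <= i <= b1 -> (p i).1 = (p b0).1) ->
  b0 <= u <= b1 -> b2 <= v <= b3 -> grid_adj (p u) (p v) -> u + v = b1 + b2.
Proof.
move=> ep [b01 _ m01] [b23 s23 m23] b12 c0 hu hv uv; have [_ pA] := ep.
(* Otherwise the segment from [b0] to [b1] could be extended to [b2]. *)
have d12 : (p b2).1 <> (p b1).1.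
  move=> e; have [] := m01 b0 b2 (leqnn _) ltac:(by lia); last by move=> _ /(congr1 val) /=; lia.
  left=> i /andP[h1 h2]; have [i1|i1] := leqP i b1; first by apply: c0; lia.
  by have -> : i = b2 by [apply: val_inj => /=; lia]; rewrite e; apply: c0; lia.
have /grid_adjP g12 : grid_adj (p b1) (p b2) by apply: pA; rewrite /path_adj; lia.
have d12' : (p b2).1 <> (p b1).1 :> nat by move=> e; apply: d12; apply: val_inj.
have e12 : (p b1).2 = (p b2).2 by apply: val_inj => /=; lia.
(* Otherwise the segment from [b2] to [b3] lies in a column and could be extended back to [b1]. *)
have c2 (i : 'I_n) : b2 <= i <= b3 -> (p i).1 = (p b2).1.
  case: s23 => [h|h]; first exact: h.
  have [] := m23 b1 b3 ltac:(by lia) (leqnn _); last by move=> /(congr1 val) /=; lia.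
  right=> j /andP[h1 h2]; have [j1|j1] := leqP b2 j; first by rewrite e12 h // j1.
  by congr ((p _).2); apply: val_inj => /=; lia.
have L0 := row_line ep c0; have L2 := row_line ep c2.
have cu : (p u).1 = (p b1).1 by rewrite !c0 //; lia.
have cv : (p v).1 = (p b2).1 by rewrite !c2.
move/grid_adjP: uv; rewrite cu cv => uv.
have uv2 : (p u).2 = (p v).2 :> nat by lia.
have {e12} : (p b1).2 = (p b2).2 :> nat by rewrite e12.
by case: L0 => L0; case: L2 => L2; move: (L0 u hu) (L0 b1 ltac:(by lia)) (L2 v hv); lia.
Qed.

Lemma fold_offset {n k l : nat} {p : 'I_n -> 'I_k * 'I_l} {b0 b1 b2 b3 u v : 'I_n} :
  embedding p -> segment p b0 b1 -> segment p b2 b3 -> b2 = b1.+1 :> nat ->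
  b0 <= u <= b1 -> b2 <= v <= b3 -> grid_adj (p u) (p v) -> u + v = b1 + b2.
Proof.
move=> ep s01 s23 b12 hu hv uv; have [_ [c0|c0] _] := s01.
  exact: (fold_offset_row ep s01 s23 b12 c0 hu hv uv).
apply: (fold_offset_row (embedding_swap ep) (segment_swap s01) (segment_swap s23) b12 c0 hu hv).
by rewrite grid_adj_swap.
Qed.

(** Records a fold by segments of the fixed embedding, so that the record survives later
    transformations. *)
Definition creased {n k l : nat} (p : 'I_n -> 'I_k * 'I_l) (J : nat -> nat) (g : nat) : Prop :=
  exists b0 b1 b2 b3 u v : 'I_n,
    [/\ [/\ segment p b0 b1, segment p b1 b2 & segment p b2 b3],
        b2 = b1.+1 :> nat /\ b2 = g :> nat, b0 <= u /\ v <= b3,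
        u + J g = g /\ v.+1 = g + J g & grid_adj (p u) (p v)].

Lemma obtainable_creased {n k l : nat} {p : 'I_n -> 'I_k * 'I_l} {E} :
  embedding p -> obtainable p E ->
  exists J, [/\ E = fold_edges n J, forall g, 0 < J g & forall g, 1 < J g -> creased p J g].
Proof.
move=> ep; elim=> [|E0 E1 _ [J [EJ J0 JC]] [b0 [b1 [b2 [b3 [u [v]]]]]]].
  by exists (fun=> 1); rewrite fold_edges_path.
case=> [[s01 s12 s23] [b12 b12E] [hu hv] uv ->].
have off := fold_offset ep s01 s23 b12 hu hv uv.
(* The edge [b1 b2] is still present and determines its crease, so [b2] has not been folded yet. *)
have Jb : J b2 = 1.
  move: b12E; rewrite EJ mem_fold_edges => /fold_adjP[g hg].
  by rewrite (_ : nat_of_ord b2 = g); have := J0 g; lia.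
pose J' (g : nat) := if g == b2 then v.+1 - b2 else J g.
have J'b : J' b2 = v.+1 - b2 by rewrite /J' eqxx.
exists J'; split.
- rewrite EJ; apply/esym/fold_edges_step => //;
    [move=> g /eqP/negbTE gb; rewrite /J' gb| |]; lia.
- by move=> g; rewrite /J'; case: eqP => // _; lia.
- move=> g; have [->|gb] := eqVneq g b2.
    by move=> _; exists b0, b1, b2, b3, u, v; split=> //; lia.
  have J'g : J' g = J g by rewrite /J' (negbTE gb).
  rewrite J'g => /JC [c0 [c1 [c2 [c3 [u' [v' [h1 h2 h3 h4 h5]]]]]]].
  by exists c0, c1, c2, c3, u', v'; rewrite J'g.
Qed.

(* Excludes folds at two consecutive path edges: they would make three distinct
   path vertices adjacent to the same two. *)
Lemma grid_common_neighbours {k l : nat} (a b c d e : 'I_k * 'I_l) :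
  a <> b -> c <> d -> c <> e -> d <> e ->
  grid_adj c a -> grid_adj d a -> grid_adj e a ->
  grid_adj c b -> grid_adj d b -> grid_adj e b -> False.
Proof.
have neq (x y : 'I_k * 'I_l) : x <> y -> x.1 <> y.1 :> nat \/ x.2 <> y.2 :> nat.
  case: x y => [x1 x2] [y1 y2] /= xy.
  have [e1|] := x1 =P y1 :> nat; last by left.
  have [e2|] := x2 =P y2 :> nat; last by right.
  by case: xy; congr (_, _); apply: val_inj.
move=> /neq ab /neq cd /neq ce /neq de.
move=> /grid_adjP ca /grid_adjP da /grid_adjP ea /grid_adjP cb /grid_adjP db /grid_adjP eb.
(* Common neighbours of [a] and [b] are the other two corners if these are diagonal, and the
   midpoint alone if they are aligned. *)
have two (x : 'I_k * 'I_l) :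
  (x.1 = a.1 :> nat /\ (x.2.+1 = a.2 \/ a.2.+1 = x.2) \/
   x.2 = a.2 :> nat /\ (x.1.+1 = a.1 \/ a.1.+1 = x.1)) ->
  (x.1 = b.1 :> nat /\ (x.2.+1 = b.2 \/ b.2.+1 = x.2) \/
   x.2 = b.2 :> nat /\ (x.1.+1 = b.1 \/ b.1.+1 = x.1)) ->
  a.1 <> b.1 :> nat /\ a.2 <> b.2 :> nat /\
    (x.1 = a.1 :> nat /\ x.2 = b.2 :> nat \/ x.1 = b.1 :> nat /\ x.2 = a.2 :> nat) \/
  (a.1 = b.1 :> nat \/ a.2 = b.2 :> nat) /\
    x.1 + x.1 = a.1 + b.1 /\ x.2 + x.2 = a.2 + b.2.
  by clear -ab => -[] [? []] ? [] [? []] ?; lia.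
have {}ca := two c ca cb; have {}da := two d da db; have {}ea := two e ea eb.
clear -ca da ea cd ce de.
by case: ca => [[? [? [] [? ?]]]|[? [? ?]]]; case: da => [[? [? [] [? ?]]]|[? [? ?]]];
  case: ea => [[? [? [] [? ?]]]|[? [? ?]]]; try lia.
Qed.

(** The fold at [g] stays within the segment that starts at [g], and this cannot properly contain
    the maximal one-edge segment of a later crease [h]; likewise from [h] towards [g]. The case
    [h = g + 1] is treated apart. *)
Lemma creased_folding {n k l : nat} {p : 'I_n -> 'I_k * 'I_l} {J} :
  embedding p -> (forall g, 0 < J g) -> (forall g, 1 < J g -> creased p J g) -> folding n J.
Proof.
move=> [pI pA] J0 JC; split=> // [g /JC|g h Jg Jh gh].
  case=> b0 [b1 [b2 [b3 [u [v [_ [b12 b2g] _ [uE vE] _]]]]]].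
  by have := ltn_ord v; lia.
have [b0 [b1 [b2 [b3 [u [v [[s01 s12 s23] [b12 b2g] [b0u vb3] [uE vE] uv]]]]]]] := JC g Jg.
have [c0 [c1 [c2 [c3 [x [y [[t01 t12 t23] [c12 c2h] [c0x yc3] [xE yE] xy]]]]]]] := JC h Jh.
have [hg|hg] := ltnP g.+1 h.
  have [_ st12 mt12] := t12; have [_ st23 ms23] := s23.
  have [_ st01 ms01] := t01; have [_ ss12 ms12] := s12.
  split; rewrite leqNgt; apply/negP => lt.
    by have [/(congr1 val) /=] := mt12 b2 b3 ltac:(by lia) ltac:(by lia) st23; lia.
  by have [_ /(congr1 val) /=] := ms12 c0 c1 ltac:(by lia) ltac:(by lia) st01; lia.
(* For [h = g + 1] maximality forces radius 2 at both creases, and [b1] and [c2] get the three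
   common neighbours [u], [b2] and [y]. *)
have b2c1 : b2 = c1 by apply: val_inj => /=; lia.
have [_ st23 ms23] := s23; have [_ st12 mt12] := t12.
have [_ /(congr1 val) /= e3] := mt12 b2 b3 ltac:(by lia) ltac:(by have := leq_trans; lia) st23.
have [_ st01 mt01] := t01; have [_ ss12 ms12] := s12.
have [/(congr1 val) /= e0 _] := ms12 c0 c1 ltac:(by lia) ltac:(by lia) st01.
have b1x : b1 = x by apply: val_inj => /=; lia.
have c2v : c2 = v by apply: val_inj => /=; lia.
have ne (i j : 'I_n) : i <> j :> nat -> p i <> p j by move=> ij /pI e; apply: ij; rewrite e.
have adj (i j : 'I_n) : i.+1 = j \/ j.+1 = i -> grid_adj (p i) (p j).
  by move=> ij; apply: pA; rewrite /path_adj; lia.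
have gC (a b : 'I_k * 'I_l) : grid_adj a b -> grid_adj b a.
  by move/grid_adjP => ab; apply/grid_adjP; lia.
case: (@grid_common_neighbours k l (p b1) (p c2) (p u) (p b2) (p y)); try (by apply: ne; lia);
  try (by apply: adj; lia).
- by apply: gC; rewrite b1x.
- by rewrite c2v.
Qed.

Lemma obtainable_folding {n k l : nat} {p : 'I_n -> 'I_k * 'I_l} {E} :
  embedding p -> obtainable p E -> exists2 J, folding n J & E = fold_edges n J.
Proof.
move=> ep /(obtainable_creased ep)[J [-> J0 JC]].
by exists J => //; exact: creased_folding ep J0 JC.
Qed.

(** * From foldings to embeddings *)

(* [c] marks the positions at which a new row starts; odd rows run leftwards. The
   first column is [n], so that no column below 0 is reached. *)
Fixpoint snake_row (c : nat -> bool) (v : nat) : nat :=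
  if v is w.+1 then snake_row c w + c v else 0.

Fixpoint snake_col (c : nat -> bool) (n v : nat) : nat :=
  if v is w.+1 then
    if c v then snake_col c n w
    else if odd (snake_row c w) then (snake_col c n w).-1 else (snake_col c n w).+1
  else n.

Lemma snake_row_le (c : nat -> bool) (v : nat) : snake_row c v <= v.
Proof. by elim: v => //= v IH; case: (c _); lia. Qed.

Lemma snake_row_mono (c : nat -> bool) (u v : nat) : u <= v -> snake_row c u <= snake_row c v.
Proof.
elim: v => [|v IH] uv; first by rewrite (_ : u = 0); lia.
have [->//|uv'] := eqVneq u v.+1.
by have := IH ltac:(by lia); rewrite /=; lia.
Qed.

Lemma snake_row_cut (c : nat -> bool) (u v w : nat) :
  u < w <= v -> c w -> snake_row c u < snake_row c v.
Proof.
case/andP=> uw wv cw; apply: leq_trans (snake_row_mono c w v wv).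
case: w uw wv cw => // w uw wv cw; rewrite [snake_row c w.+1]/= cw addn1 ltnS.
exact: snake_row_mono.
Qed.

Lemma snake_col_bound (c : nat -> bool) (n v : nat) :
  n <= snake_col c n v + v /\ snake_col c n v <= n + v.
Proof. by elim: v => [|v IH] /=; [|case: ifP => _; [|case: ifP => _]]; lia. Qed.

Lemma snake_line (c : nat -> bool) (n u v : nat) :
  u <= v <= n -> (forall w, u < w <= v -> ~~ c w) ->
  snake_row c v = snake_row c u /\
  (if odd (snake_row c u) then snake_col c n v + (v - u) = snake_col c n u
   else snake_col c n v = snake_col c n u + (v - u)).
Proof.
elim: v => [|v IH] uv nc; first by have -> : u = 0; [lia|rewrite /=; lia].
have [->|uv'] := eqVneq u v.+1; first by split=> //; case: (odd _); lia.
have [//||Er Ec] := IH; [by lia|by move=> w hw; apply: nc; lia|].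
have ncv : c v.+1 = false by apply/negbTE/nc; lia.
have [b1 b2] := snake_col_bound c n v.
by rewrite /= ncv addn0 Er; split=> //; move: Ec; case: ifP => _; lia.
Qed.

Lemma snake_embeds (c : nat -> bool) (n : nat) :
  exists2 p : 'I_n -> 'I_n * 'I_(n.*2), embedding p
    & forall v : 'I_n, (p v).1 = snake_row c v :> nat /\ (p v).2 = snake_col c n v :> nat.
Proof.
have ltr (v : 'I_n) : snake_row c v < n by have := snake_row_le c v; have := ltn_ord v; lia.
have ltc (v : 'I_n) : snake_col c n v < n.*2.
  by have := snake_col_bound c n v; have := ltn_ord v; lia.
exists (fun v => (Ordinal (ltr v), Ordinal (ltc v))) => //; split.
  (* Positions in one row have no cut between them, and the column is strictly monotone along a
     row. *)
  have half (u v : 'I_n) : u <= v -> snake_row c u = snake_row c v ->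
      snake_col c n u = snake_col c n v -> u = v.
    move=> uv er ec; apply: val_inj => /=.
    have uvn : u <= v <= n by have := ltn_ord v; lia.
    have nc w : u < w <= v -> ~~ c w.
      by move=> hw; apply/negP => cw; have := snake_row_cut c u v w hw cw; lia.
    by have [_] := snake_line c n u v uvn nc; case: ifP => _; lia.
  move=> u v [er ec]; case/orP: (leq_total u v) => uv; first exact: half.
  by apply/esym/half.
have step (i j : 'I_n) : i.+1 = j ->
    grid_adj (Ordinal (ltr i), Ordinal (ltc i)) (Ordinal (ltr j), Ordinal (ltc j)).
  move=> ij; apply/grid_adjP; rewrite /= -ij /=; have := ltn_ord i.
  have := snake_col_bound c n i; case: ifP => ci; first by lia.
  by case: ifP => _; lia.
move=> i j /orP[]/eqP ij; first exact: step.
by have /grid_adjP h := step _ _ ij; apply/grid_adjP; lia.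
Qed.

(** A longer stretch in the row would cross a cut, which changes the row; the step from [b] to
    [b + 1] rules out a column. *)
Lemma snake_segment_row {c n k l} {p : 'I_n -> 'I_k * 'I_l} {b e : 'I_n} :
  (forall v : 'I_n, (p v).1 = snake_row c v :> nat /\ (p v).2 = snake_col c n v :> nat) ->
  b < e -> (forall w, b < w <= e -> ~~ c w) -> b = 0 :> nat \/ c b -> e.+1 = n \/ c e.+1 ->
  segment p b e.
Proof.
move=> pE be nc cb ce; split=> //.
  left=> i hi; apply: val_inj; rewrite /= !(proj1 (pE _)).
  have [||->//] := snake_line c n b i; first by have := ltn_ord i; lia.
  by move=> w hw; apply: nc; lia.
move=> b' e' bb ee st; have e'n := ltn_ord e'.
have en := ltn_ord e.
case: st => [st|st]; last first.
  have hb1 : b.+1 < n by lia.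
  have := st b ltac:(by lia).
  rewrite -(st (Ordinal hb1)) => [/(congr1 val)/=|]; last by rewrite /=; lia.
  rewrite !(proj2 (pE _)) /=; have := snake_col_bound c n b.
  by rewrite (negbTE (nc _ _)); [case: ifP => _|]; lia.
have re : snake_row c b' = snake_row c e'.
  by rewrite -!(proj1 (pE _)) st //; lia.
have nc' w : b' < w <= e' -> ~ c w.
  by move=> hw cw; have := snake_row_cut c b' e' w hw cw; lia.
split; apply: val_inj => /=; apply/eqP; rewrite eqn_leq.
  rewrite bb leqNgt; apply/negP => lt; case: cb => [|cb]; first by lia.
  by apply: (nc' b) => //; lia.
rewrite ee andbT leqNgt; apply/negP => lt; case: ce => [|ce]; first by lia.
by apply: (nc' e.+1) => //; lia.
Qed.

(** The steps into [b] and out of [e] change the column, so the segment is a single edge. *)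
Lemma snake_segment_cut {c n k l} {p : 'I_n -> 'I_k * 'I_l} {b e : 'I_n} :
  (forall v : 'I_n, (p v).1 = snake_row c v :> nat /\ (p v).2 = snake_col c n v :> nat) ->
  e = b.+1 :> nat -> c e -> ~~ c b -> ~~ c e.+1 -> segment p b e.
Proof.
move=> pE eb ce ncb nce; split; first by lia.
  right=> i hi; apply: val_inj; rewrite /= !(proj2 (pE _)).
  have [->//|ib] := eqVneq i b; rewrite (_ : nat_of_ord i = b.+1) /= -?eb ?ce //.
  by have : i != b :> nat by []; lia.
move=> b' e' bb ee st; have e'n := ltn_ord e'; have bn := ltn_ord b.
have move1 w : ~~ c w.+1 -> w < n -> snake_col c n w.+1 <> snake_col c n w.
  by move=> cw wn /=; rewrite (negbTE cw); have := snake_col_bound c n w; case: ifP => _; lia.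
case: st => st.
  have re : snake_row c b' = snake_row c e'.
    by rewrite -!(proj1 (pE _)) st //; lia.
  by have := snake_row_cut c b' e' e ltac:(by lia) ce; lia.
have same (i j : 'I_n) : b' <= i <= e' -> b' <= j <= e' -> snake_col c n i = snake_col c n j.
  by move=> hi hj; rewrite -!(proj2 (pE _)) !st.
split; apply: val_inj => /=; apply/eqP; rewrite eqn_leq.
  rewrite bb leqNgt; apply/negP => lt.
  have b0 : b.-1 < n by lia.
  case: (move1 b.-1 _ b0); rewrite prednK; try lia => //.
  by apply: (same b (Ordinal b0)); rewrite /=; lia.
rewrite ee andbT leqNgt; apply/negP => lt.
have e1 : e.+1 < n by lia.
by case: (move1 e nce (ltn_ord e)); apply: (same (Ordinal e1) e); rewrite /=; lia.
Qed.

Lemma previous_cut (c : nat -> bool) (v : nat) :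
  exists b, [/\ b <= v, b = 0 \/ c b & forall w, b < w <= v -> ~~ c w].
Proof.
elim: v => [|v [b [bv cb nc]]]; first by exists 0; split=> //; [left|lia].
case cv : (c v.+1); first by exists v.+1; split=> //; [right|lia].
exists b; split=> //; first by lia.
by move=> w hw; have [->|wv] := eqVneq w v.+1; [rewrite cv|apply: nc; lia].
Qed.

Lemma next_cut (c : nat -> bool) (n v : nat) : v < n ->
  exists e, [/\ v <= e < n, e.+1 = n \/ c e.+1 & forall w, v < w <= e -> ~~ c w].
Proof.
move=> vn; have [d] : exists d, n - v = d.+1 by exists (n - v).-1; lia.
elim: d v vn => [|d IH] v vn dE; first by exists v; split; [lia|left; lia|lia].
case cv : (c v.+1); first by exists v; split; [lia|right|lia].
have [e [ve ce nc]] := IH v.+1 ltac:(by lia) ltac:(by lia).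
exists e; split=> //; first by lia.
by move=> w hw; have [->|wv] := eqVneq w v.+1; [rewrite cv|apply: nc; lia].
Qed.

(** Rows are cut at the creases and alternate in direction, so positions symmetric about a crease
    and within its reach share a column. The folds are made from left to right. *)
Lemma folding_obtainable {n J} : folding n J ->
  exists k l (p : 'I_n -> 'I_k * 'I_l), embedding p /\ obtainable p (fold_edges n J).
Proof.
move=> FJ; have [J0 Jbnd Jsep] := FJ; pose c g := 1 < J g.
have [p ep pE] := snake_embeds c n; exists n, n.*2, p; split=> //.
have ext J1 J2 : J1 =1 J2 -> fold_edges n J1 = fold_edges n J2.
  move=> e; apply/setP=> A; apply/fold_edgesP/fold_edgesP => -[u [v [-> uv]]];
    by exists u, v; split=> //; move: uv; rewrite /fold_adj e.
(* The radii once the creases below [i] have been folded. *)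
pose K i g := if g < i then J g else 1.
suff obt i : obtainable p (fold_edges n (K i)).
  rewrite (ext J (K n)) // => g; rewrite /K; case: ltnP => // ng.
  by have := J0 g; have [Jg|] := ltnP 1 (J g); [have := Jbnd _ Jg|]; lia.
elim: i => [|g IH].
  by rewrite (ext _ (fun=> 1)) // fold_edges_path; constructor.
have Kg h : h <> g -> K g.+1 h = K g h by rewrite /K => hg; have -> : (h < g.+1) = (h < g) by lia.
have KgE : K g.+1 g = J g by rewrite /K ltnSn.
have Kg1 : K g g = 1 by rewrite /K ltnn.
have [Jg|Jg] := leqP (J g) 1.
  rewrite (ext _ (K g)) // => h; have [->|/eqP/Kg //] := eqVneq h g.
  by rewrite KgE Kg1; have := J0 g; lia.
have [Jg1 Jg2] := Jbnd _ Jg.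
have gap h : g - J g < h < g + J g -> h <> g -> ~~ c h.
  by move=> h1 h2; rewrite /c (folding_gap FJ Jg h1 h2).
(* [b0'] begins the row that ends at [g - 1], and [b3'] ends the row that begins at [g]. *)
have [b0' [b0le cb0 nb0]] := previous_cut c g.-1.
have [b3' [b3le cb3 nb3]] := next_cut c n g ltac:(by lia).
have b0u : b0' + J g <= g.
  by case: cb0 => [->|cb]; [lia|have := Jsep _ _ cb Jg ltac:(by lia); lia].
have b3v : g + J g <= b3'.+1.
  by case: cb3 => [->|cb]; [lia|have := Jsep _ _ Jg cb ltac:(by lia); lia].
have lt0 : b0' < n by lia.
have lt1 : g.-1 < n by lia.
have lt2 : g < n by lia.
have lt3 : b3' < n by lia.
have ltu : g - J g < n by lia.
have ltv : (g + J g).-1 < n by lia.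
apply: (obtainable_step IH).
exists (Ordinal lt0), (Ordinal lt1), (Ordinal lt2), (Ordinal lt3), (Ordinal ltu), (Ordinal ltv).
split.
- split.
  + by apply: (snake_segment_row pE) => //=; [lia|right; rewrite prednK //; lia].
  + by apply: (snake_segment_cut pE) => //=; [lia|apply: gap; lia|apply: gap; lia].
  + by apply: (snake_segment_row pE) => //=; [lia|right].
- split; first by rewrite /=; lia.
  by rewrite mem_fold_edges; apply: (@fold_adj_crease _ g); rewrite Kg1 /=; lia.
- by rewrite /=; lia.
(* Both ends lie [J g - 1] columns to the same side of the column shared by [g - 1] and [g], as the
   two rows run in opposite directions. *)
- apply/grid_adjP; rewrite !(proj1 (pE _)) !(proj2 (pE _)) /=.
  have [||r1 c1] := snake_line c n (g - J g) g.-1; [lia|by move=> w hw; apply: gap; lia|].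
  have [||r2 c2] := snake_line c n g (g + J g).-1; [lia|by move=> w hw; apply: gap; lia|].
  have rg : snake_row c g = (snake_row c g.-1).+1.
    by rewrite -{1}(@prednK g) /= ?prednK /c ?Jg ?addn1 //; lia.
  have cg : snake_col c n g = snake_col c n g.-1.
    by rewrite -{1}(@prednK g) /= ?prednK /c ?Jg //; lia.
  move: c1 c2; rewrite rg -r1 /= cg r2 rg; case: (odd _) => /= c1 c2; lia.
- apply: (@fold_edges_step _ (K g)) => //=; rewrite ?KgE; try lia.
Qed.

(** * The characterisation *)

Lemma path_like_folding {V : finType} {T : rel V} {n : nat} {J : nat -> nat} :
  folding n J -> graph_iso T (fold_graph n J) -> path_like T.
Proof.
move=> FJ iT; have nV : n = #|V|.
  by case: iT => f bf _; rewrite (bij_eq_card bf) card_ord.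
subst n; have [k [l [p [ep op]]]] := folding_obtainable FJ.
exists k, l, p, (fold_edges #|V| J); split=> //.
by case: iT => f bf fE; exists f => // x y; rewrite mem_fold_edges fE.
Qed.

Lemma path_like_blocks {V : finType} {T : rel V} {m x k y : nat} :
  0 < m -> 0 < k -> 0 < x <= y ->
  graph_iso T (@cH_adj (k * y) (m * x) (y - x + 1)) -> path_like T.
Proof.
move=> m0 k0 xy iT.
apply: (path_like_folding (block_fold_folding (m * x + k * y) m x k y k0 xy erefl)).
exact: graph_iso_trans iT (graph_iso_sym (block_fold_iso _ _ _ _ _ m0 k0 xy erefl)).
Qed.

Lemma cH_adj_rev {s t a : nat} : 0 < a <= s ->
  graph_iso (@cH_adj s t a) (@cH_adj s t (s - a + 1)).
Proof.
move=> ha; pose f (z : 'I_s + 'I_t) : 'I_s + 'I_t :=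
  match z with inl i => inl (rev_ord i) | inr j => inr j end.
have fK : cancel f f by case=> //= i; rewrite rev_ordK.
exists f; first by exists f.
case=> [i|i] [j|j] //=; rewrite /path_adj /=; have := ltn_ord i; have := ltn_ord j; lia.
Qed.

Theorem theorem6 (V : finType) (T : rel V) (hT : type_cH T) :
  path_like T <->
  exists s t a : nat, cH_parameters T s t a /\
    [\/ exists alpha beta : nat,
          [/\ alpha %| s, beta %| t, alpha - beta = a - 1 & s - a >= a - 1],
        s - a + 1 = t \/ a = t
      | a %| t \/ s - a + 1 %| t].
Proof.
split=> [[k0 [l0 [p [E [ep op iE]]]]]|].
  have [J FJ EJ] := obtainable_folding ep op.
  have iT : graph_iso T (fold_graph #|V| J).
    by case: iE => f bf fE; exists f => // x y; rewrite fE EJ mem_fold_edges.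
  have [s [t [a [ha ht iH]]]] := hT.
  have BJ := one_branch_iso (graph_iso_trans (graph_iso_sym iT) iH) (cH_one_branch _ _ _ ha ht).
  have [m [x [k [y [m0 k1 xy nE iB]]]]] := folding_blocks FJ BJ.
  have x0y : 0 < x <= y by lia.
  have iC := block_fold_iso _ m x k y m0 k1 x0y nE.
  have ky : y <= k * y by rewrite leq_pmull.
  have mx : 0 < m * x by rewrite muln_gt0 m0; lia.
  exists (k * y), (m * x), (y - x + 1); split.
    by split=> //; [lia|exact: graph_iso_trans iT (graph_iso_trans iB iC)].
  (* For [k >= 2], [s - a] is at least [y + x - 1]; for [k = 1], [s - a + 1] is [x], a divisor of
     [m * x]. *)
  have [k2|k2] := leqP 2 k.
    constructor 1; exists y, x; split; rewrite ?dvdn_mull //; first by lia.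
    have : 2 * y <= k * y by rewrite leq_mul2r k2 orbT.
    by lia.
  constructor 3; right; rewrite (_ : k * y - _ + 1 = x) ?dvdn_mull //.
  by rewrite (_ : k = 1); lia.
case=> s [t [a [[ha ht iT] cond]]].
(* Rows of width [a] followed by one row of width [s] give the parameter [s - a + 1]; reversing [u]
   turns it into [a]. *)
have left_leg : a %| t -> path_like T.
  case/dvdnP=> m tE; subst t; have m0 : 0 < m by move: ht; rewrite muln_gt0 => /andP[].
  apply: (@path_like_blocks _ _ m a 1 s) => //; first by lia.
  by rewrite mul1n; apply: graph_iso_trans iT (cH_adj_rev _); lia.
have right_leg : s - a + 1 %| t -> path_like T.
  case/dvdnP=> m tE; subst t; have m0 : 0 < m by move: ht; rewrite muln_gt0 => /andP[].
  apply: (@path_like_blocks _ _ m (s - a + 1) 1 s) => //; first by lia.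
  by rewrite mul1n (_ : s - (s - a + 1) + 1 = a) //; lia.
case: cond => [[al [be [/dvdnP[k sE] /dvdnP[m tE] ab _]]]|[] e|[]] //.
(* Since [1 < a], the truncated difference is positive, so [be < al] are the widths of the two
   blocks. *)
- subst s t; have aE : a = al - be + 1 by lia.
  have k0 : 0 < k by rewrite lt0n; apply/eqP => k0; move: ha; rewrite k0; lia.
  move: ht; rewrite muln_gt0 => /andP[m0 be0].
  by rewrite aE in iT; apply: path_like_blocks iT => //; lia.
(* Condition (ii) is the instance of (iii) in which the divisor is [t] itself. *)
- by apply: right_leg; rewrite e.
- by apply: left_leg; rewrite e.
Qed.
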